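(* Let $M$ and $N$ be finitely generated monoids, each having only finitely many left ideals and finitely many right ideals, and suppose $M$ and $N$ are quasi-isometric. If $M$ is finitely presented with solvable word problem, then $N$ is finitely presented with solvable word problem.
   Context: For a monoid $S$ generated by a finite set $A$, $d_A(x,y)=\inf\{|w|:w\in A^*,\ xw=y\}$ ($A^*$ the free monoid on $A$, $\inf\emptyset=\infty$). A map $f:(S,d_A)\to(T,d_B)$ is a quasi-isometry if there are $1\le\lambda<\infty$, $0<\epsilon<\infty$, $0\le\mu<\infty$ with $\frac1\lambda d_A(x,y)-\epsilon\le d_B(f(x),f(y))\le\lambda d_A(x,y)+\epsilon$ for all $x,y$, and for each $t\in T$ some $x\in S$ with $\max(d_B(t,f(x)),d_B(f(x),t))\le\mu$. Monoids $S,T$ are quasi-isometric if $(S,d_A)$, $(T,d_B)$ are quasi-isometric for some finite generating sets $A,B$. ''Finitely presented with solvable word problem'' means the monoid admits a finite presentation for which the word problem is decidable. *)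

(* Defs.v *)
From Stdlib Require Import Reals List Arith.
Import ListNotations.
Open Scope R_scope.

Record monoid := Monoid {
  mcar :> Type;
  mmul : mcar -> mcar -> mcar;
  munit : mcar;
  massoc : forall x y z, mmul x (mmul y z) = mmul (mmul x y) z;
  mul1m : forall x, mmul munit x = x;
  mulm1 : forall x, mmul x munit = x }.

Definition mprod (M : monoid) (w : list M) : M := fold_right (mmul M) (munit M) w.

Definition word_over (M : monoid) (A : list M) (w : list M) : Prop :=
  Forall (fun a => In a A) w.

Definition generates (M : monoid) (A : list M) : Prop :=
  forall x : M, exists w, word_over M A w /\ mprod M w = x.

Definition finitely_generated (M : monoid) : Prop :=
  exists A : list M, generates M A.

(** [dist_le A x y r] means d_A(x,y) <= r, where
    d_A(x,y) = inf { |w| : w in A^*, x w = y } (inf of the empty set = oo).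
    Since the infimum of a nonempty set of naturals is attained,
    d_A(x,y) <= r iff some such word has length <= r. *)
Definition dist_le (M : monoid) (A : list M) (x y : M) (r : R) : Prop :=
  exists w, word_over M A w /\ mmul M x (mprod M w) = y /\ INR (length w) <= r.

(** f : (M,d_A) -> (N,d_B) is a quasi-isometry:
    (1/lam) d_A(x,y) - eps <= d_B(fx,fy) <= lam d_A(x,y) + eps  (values in [0,oo])
    and every t is within mu (in both directions) of some f x.
    The upper bound is stated as: d_A(x,y) <= r -> d_B(fx,fy) <= lam r + eps;
    the lower bound as: d_B(fx,fy) <= r -> d_A(x,y) <= lam (r + eps). *)
Definition quasi_isometry (M N : monoid) (A : list M) (B : list N) (f : M -> N) : Prop :=
  exists lam eps mu : R,
    1 <= lam /\ 0 < eps /\ 0 <= mu /\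
    (forall x y r, dist_le M A x y r -> dist_le N B (f x) (f y) (lam * r + eps)) /\
    (forall x y r, dist_le N B (f x) (f y) r -> dist_le M A x y (lam * (r + eps))) /\
    (forall t : N, exists x : M, dist_le N B t (f x) mu /\ dist_le N B (f x) t mu).

Definition quasi_isometric (M N : monoid) : Prop :=
  exists (A : list M) (B : list N) (f : M -> N),
    generates M A /\ generates N B /\ quasi_isometry M N A B f.

Definition left_ideal (M : monoid) (I : M -> Prop) : Prop :=
  forall m x : M, I x -> I (mmul M m x).
Definition right_ideal (M : monoid) (I : M -> Prop) : Prop :=
  forall m x : M, I x -> I (mmul M x m).

Definition finitely_many (M : monoid) (P : (M -> Prop) -> Prop) : Prop :=
  exists L : list (M -> Prop),
    forall I, P I -> exists J, In J L /\ forall x, I x <-> J x.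

Inductive recf : Type :=
| RZero : recf
| RSucc : recf
| RProj : nat -> recf
| RComp : recf -> list recf -> recf
| RPrec : recf -> recf -> recf
| RMin  : recf -> recf.

Inductive reval : recf -> list nat -> nat -> Prop :=
| ev_zero v : reval RZero v 0
| ev_succ x v : reval RSucc (x :: v) (S x)
| ev_proj i v : (i < length v)%nat -> reval (RProj i) v (nth i v 0%nat)
| ev_comp f gs v ws y : revals gs v ws -> reval f ws y -> reval (RComp f gs) v y
| ev_prec0 f g v y : reval f v y -> reval (RPrec f g) (0%nat :: v) y
| ev_precS f g n v z y :
    reval (RPrec f g) (n :: v) z -> reval g (n :: z :: v) y ->
    reval (RPrec f g) (S n :: v) y
| ev_min f v n :
    reval f (n :: v) 0%nat ->
    (forall m, (m < n)%nat -> exists k, reval f (m :: v) (S k)) ->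
    reval (RMin f) v n
with revals : list recf -> list nat -> list nat -> Prop :=
| evs_nil v : revals [] v []
| evs_cons g gs v y ys : reval g v y -> revals gs v ys -> revals (g :: gs) v (y :: ys).

Definition decidable_nat (P : nat -> Prop) : Prop :=
  exists f : recf, forall n,
    (P n -> reval f [n] 1%nat) /\ (~ P n -> reval f [n] 0%nat).

Definition cpair (n m : nat) : nat := ((n + m) * (n + m + 1) / 2 + m)%nat.
Fixpoint code_word (w : list nat) : nat :=
  match w with
  | [] => 0%nat
  | a :: l => S (cpair a (code_word l))
  end.

Inductive rcong (Rel : list (list nat * list nat)) : list nat -> list nat -> Prop :=
| rc_refl u : rcong Rel u u
| rc_sym u v : rcong Rel u v -> rcong Rel v u
| rc_trans u v w : rcong Rel u v -> rcong Rel v w -> rcong Rel u w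
| rc_step p l r s : In (l, r) Rel -> rcong Rel (p ++ l ++ s) (p ++ r ++ s).

Definition letters_lt (k : nat) (w : list nat) : Prop := Forall (fun i => (i < k)%nat) w.

Definition pres_eval (M : monoid) (gens : list M) (w : list nat) : M :=
  mprod M (map (fun i => nth i gens (munit M)) w).

Definition is_finite_presentation (M : monoid) (gens : list M)
    (Rel : list (list nat * list nat)) : Prop :=
  let k := length gens in
  Forall (fun lr => letters_lt k (fst lr) /\ letters_lt k (snd lr)) Rel /\
  (forall x : M, exists w, letters_lt k w /\ pres_eval M gens w = x) /\
  (forall u v, letters_lt k u -> letters_lt k v ->
     (pres_eval M gens u = pres_eval M gens v <-> rcong Rel u v)).

Definition solvable_word_problem (k : nat) (Rel : list (list nat * list nat)) : Prop :=
  decidable_nat (fun n => exists u v, letters_lt k u /\ letters_lt k v /\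
                    n = cpair (code_word u) (code_word v) /\ rcong Rel u v).

Definition fp_solvable_wp (M : monoid) : Prop :=
  exists (gens : list M) (Rel : list (list nat * list nat)),
    is_finite_presentation M gens Rel /\ solvable_word_problem (length gens) Rel.

(* Main.v *)
(** For a finite presentation, a computable bound on the length of derivations decides the word
    problem, since the words within [n] rewriting steps of a given word can be listed.
    Conversely, if the word problem is solvable, searching for a derivation of each true equation
    of a given size computes such a bound.

    Geometrically, the bound says that two paths of length at most [n] from 1 to the same point
    of the Cayley graph are linked by boundedly many moves, each replacing a subpath of bounded
    length by another one with the same ends.  This passes through a quasi-isometry [f] with
    quasi-inverse [g]: send a pair of paths to [M] by [g], move one to the other there, come back
    by [f], and compare a path with its round trip by a ladder whose rungs are bounded paths.
    The path in [M] starts at [g 1] instead of 1, which is harmless because [g 1] is right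
    invertible.

    Bounded homotopies give back a finite presentation when there are finitely many left ideals.
    The move [l -> r] is allowed at [x] when [x l = x r], which depends only on the L-class of
    [x].  Representing the finitely many L-classes by short words [y], the relations
    [y i = q y'] ([i] a generator, [y'] short, in the L-class of [y i]) rewrite any word of
    value [x] to one that ends in a short [y] in the L-class of [x], and then [y l = y r] is a
    true relation of bounded length.  So the true relations of bounded length form a
    presentation, and every move costs linearly many rewriting steps. *)

From Stdlib Require Import Reals List Arith Lia Lra ClassicalEpsilon.
From Stdlib Require Cantor.
Require Import Defs.
Import ListNotations.
Local Open Scope nat_scope.

(** * Partial recursive programs for Cantor pairing *)

Definition rf_one : recf := RComp RSucc [RZero].
Definition rf_pred : recf := RPrec RZero (RProj 0).
Definition rf_add : recf := RPrec (RProj 0) (RComp RSucc [RProj 1]).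
Definition rf_sub : recf :=
  RComp (RPrec (RProj 0) (RComp rf_pred [RProj 1])) [RProj 1; RProj 0].
Definition rf_triangle : recf := RPrec RZero (RComp rf_add [RComp RSucc [RProj 0]; RProj 1]).
Definition rf_pair : recf :=
  RComp rf_add [RProj 1; RComp rf_triangle [RComp rf_add [RProj 1; RProj 0]]].

Ltac reval :=
  repeat match goal with
  | |- reval RZero _ _ => apply ev_zero
  | |- reval RSucc _ _ => apply ev_succ
  | |- reval (RProj ?i) ?v _ => apply (ev_proj i v); simpl; lia
  | |- reval (RComp _ _) _ _ => eapply ev_comp
  | |- revals [] _ _ => apply evs_nil
  | |- revals (_ :: _) _ _ => apply evs_cons
  | |- _ => eassumption
  | H : forall _, reval ?e _ _ |- reval ?e _ _ => apply H
  | H : forall _ _, reval ?e _ _ |- reval ?e _ _ => apply H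
  end.

Lemma reval_one v : reval rf_one v 1.
Proof. unfold rf_one. reval. Qed.

Lemma reval_pred x : reval rf_pred [x] (pred x).
Proof.
  induction x as [|x IH]; [apply ev_prec0 | eapply ev_precS; [exact IH|]]; reval.
Qed.

Lemma reval_add x y : reval rf_add [x; y] (x + y).
Proof.
  induction x as [|x IH]; [apply ev_prec0 | eapply ev_precS; [exact IH|]]; reval.
Qed.

Lemma reval_sub x y : reval rf_sub [x; y] (x - y).
Proof.
  pose proof reval_pred. unfold rf_sub. reval. simpl.
  induction y as [|y IH]; [apply ev_prec0 | eapply ev_precS; [exact IH|]].
  - rewrite Nat.sub_0_r. reval.
  - rewrite Nat.sub_succ_r. reval.
Qed.

Definition triangle (n : nat) : nat := nat_rec _ 0 (fun i m => S i + m) n.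

Lemma reval_triangle x : reval rf_triangle [x] (triangle x).
Proof.
  pose proof reval_add.
  induction x as [|x IH]; [apply ev_prec0 | eapply ev_precS; [exact IH|]]; reval.
Qed.

Lemma cpair_cantor x y : cpair x y = Cantor.to_nat (x, y).
Proof.
  rewrite Cantor.to_nat_spec2. unfold cpair.
  now rewrite Nat.add_comm, Nat.add_1_r, (Nat.add_comm x y).
Qed.

Lemma reval_pair x y : reval rf_pair [x; y] (cpair x y).
Proof.
  rewrite cpair_cantor. change (Cantor.to_nat (x, y)) with (y + triangle (y + x)).
  pose proof reval_add. pose proof reval_triangle. unfold rf_pair. reval.
Qed.

Definition cfst (n : nat) : nat := fst (Cantor.of_nat n).
Definition csnd (n : nat) : nat := snd (Cantor.of_nat n).
Definition cdiag (n : nat) : nat := csnd n + cfst n.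

Lemma cfst_cpair x y : cfst (cpair x y) = x.
Proof. unfold cfst. now rewrite cpair_cantor, Cantor.cancel_of_to. Qed.

Lemma csnd_cpair x y : csnd (cpair x y) = y.
Proof. unfold csnd. now rewrite cpair_cantor, Cantor.cancel_of_to. Qed.

Lemma cpair_surj n : cpair (cfst n) (csnd n) = n.
Proof.
  rewrite cpair_cantor. unfold cfst, csnd. rewrite <- surjective_pairing.
  apply Cantor.cancel_to_of.
Qed.

Lemma cdiag_triangle n : n = csnd n + triangle (cdiag n).
Proof. rewrite <- (cpair_surj n) at 1. now rewrite cpair_cantor. Qed.

(* The Cantor enumeration starts a new diagonal after a point whose first coordinate is 0. *)
Lemma cdiag_succ n : cdiag (S n) = cdiag n + (1 - (cdiag n + triangle (cdiag n) - n)).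
Proof.
  pose proof (cdiag_triangle n) as E. unfold cdiag, cfst, csnd in *.
  change (Cantor.of_nat (S n)) with
    (let '(x, y) := Cantor.of_nat n in match x with S x => (x, S y) | 0 => (S y, 0) end).
  destruct (Cantor.of_nat n) as [[|x] y]; simpl fst in *; simpl snd in *; lia.
Qed.

Definition rf_diag : recf :=
  RPrec RZero (RComp rf_add [RProj 1; RComp rf_sub [rf_one;
    RComp rf_sub [RComp rf_add [RProj 1; RComp rf_triangle [RProj 1]]; RProj 0]]]).
Definition rf_snd : recf := RComp rf_sub [RProj 0; RComp rf_triangle [rf_diag]].
Definition rf_fst : recf := RComp rf_sub [rf_diag; rf_snd].

Lemma reval_diag n : reval rf_diag [n] (cdiag n).
Proof.
  pose proof reval_one. pose proof reval_add. pose proof reval_sub. pose proof reval_triangle.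
  induction n as [|n IH]; [apply ev_prec0 | eapply ev_precS; [exact IH|]].
  - reval.
  - rewrite cdiag_succ. reval.
Qed.

Lemma reval_snd n : reval rf_snd [n] (csnd n).
Proof.
  replace (csnd n) with (n - triangle (cdiag n)) by (pose proof (cdiag_triangle n); lia).
  pose proof reval_diag. pose proof reval_sub. pose proof reval_triangle. unfold rf_snd. reval.
Qed.

Lemma reval_fst n : reval rf_fst [n] (cfst n).
Proof.
  replace (cfst n) with (cdiag n - csnd n) by (unfold cdiag; lia).
  pose proof reval_diag. pose proof reval_snd. pose proof reval_sub. unfold rf_fst. reval.
Qed.

(** * Computable functions between coded types *)

Class coding (X : Type) := {
  code : X -> nat;
  code_inj : forall x y, code x = code y -> x = y }.

#[local] Instance coding_nat : coding nat := {| code n := n; code_inj _ _ E := E |}.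

#[local, refine] Instance coding_bool : coding bool := {| code := Nat.b2n |}.
Proof. intros [] [] E; (reflexivity || discriminate). Defined.

#[local, refine] Instance coding_prod {X Y} `{coding X} `{coding Y} : coding (X * Y) :=
  {| code p := cpair (code (fst p)) (code (snd p)) |}.
Proof.
  intros [x y] [x' y'] E. simpl in E.
  f_equal; apply code_inj.
  - now rewrite <- (cfst_cpair (code x) (code y)), E, cfst_cpair.
  - now rewrite <- (csnd_cpair (code x) (code y)), E, csnd_cpair.
Defined.

#[local, refine] Instance coding_list {X} `{coding X} : coding (list X) :=
  {| code := fold_right (fun x n => S (cpair (code x) n)) 0 |}.
Proof.
  induction x as [|x l IH]; intros [|y l'] E; try discriminate; auto.
  injection E as E. set (c := fold_right _ 0 l) in *. set (c' := fold_right _ 0 l') in *.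
  assert (P : (x, c) = (y, c')) by now apply code_inj.
  injection P as -> E'. f_equal. auto.
Defined.

Definition computable {X Y} `{coding X} `{coding Y} (f : X -> Y) : Prop :=
  exists e, forall x, reval e [code x] (code (f x)).

Local Notation computable2 f := (computable (fun p => f (fst p) (snd p))).
Local Notation computable3 f := (computable (fun p => f (fst (fst p)) (snd (fst p)) (snd p))).

Section Composition.
Context {X Y Z : Type} `{HX : coding X} `{HY : coding Y} `{HZ : coding Z}.

Lemma computable_ext (f g : X -> Y) : (forall x, f x = g x) -> computable f -> computable g.
Proof. intros E [e He]. exists e. intros x. rewrite <- E. apply He. Qed.

Lemma computable_id : computable (fun x : X => x).
Proof. exists (RProj 0). intros x. reval. Qed.

Lemma computable_comp (g : Y -> Z) (f : X -> Y) :
  computable g -> computable f -> computable (fun x => g (f x)).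
Proof. intros [d Hd] [e He]. exists (RComp d [e]). intros x. reval. Qed.

Lemma computable_const (y : Y) : computable (fun _ : X => y).
Proof.
  unfold computable. generalize (code y) as c. induction c as [|c [e IH]].
  - exists RZero. intros x. reval.
  - exists (RComp RSucc [e]). intros x. reval.
Qed.

Lemma computable_unary e (op : nat -> nat) (F : X -> nat) :
  (forall n, reval e [n] (op n)) -> computable F -> computable (fun x => op (F x)).
Proof. intros He [d Hd]. exists (RComp e [d]). intros x. reval. Qed.

Lemma computable_binary e (op : nat -> nat -> nat) (F G : X -> nat) :
  (forall n m, reval e [n; m] (op n m)) -> computable F -> computable G ->
  computable (fun x => op (F x) (G x)).
Proof. intros He [c Hc] [d Hd]. exists (RComp e [c; d]). intros x. reval. Qed.

Lemma computable_via_code (f : X -> Y) (c : X -> nat) :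
  (forall x, code (f x) = c x) -> computable f <-> computable c.
Proof.
  intros E. split; intros [e He]; exists e; intros x; [rewrite <- E | rewrite E]; apply He.
Qed.

End Composition.

Section DataTypes.
Context {X Y Z : Type} `{HX : coding X} `{HY : coding Y} `{HZ : coding Z}.

Lemma computable_pair (f : X -> Y) (g : X -> Z) :
  computable f -> computable g -> computable (fun x => (f x, g x)).
Proof. exact (computable_binary rf_pair cpair _ _ reval_pair). Qed.

Lemma computable_fst (f : X -> Y * Z) : computable f -> computable (fun x => fst (f x)).
Proof.
  intros Hf. apply computable_via_code with (c := fun x => cfst (code (f x))).
  - intros x. symmetry. apply cfst_cpair.
  - exact (computable_unary _ _ _ reval_fst Hf).
Qed.

Lemma computable_snd (f : X -> Y * Z) : computable f -> computable (fun x => snd (f x)).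
Proof.
  intros Hf. apply computable_via_code with (c := fun x => csnd (code (f x))).
  - intros x. symmetry. apply csnd_cpair.
  - exact (computable_unary _ _ _ reval_snd Hf).
Qed.

Lemma computable_succ (F : X -> nat) : computable F -> computable (fun x => S (F x)).
Proof. apply computable_unary with (e := RSucc). intros n. reval. Qed.

Lemma computable_pred (F : X -> nat) : computable F -> computable (fun x => pred (F x)).
Proof. exact (computable_unary _ _ _ reval_pred). Qed.

Lemma computable_add (F G : X -> nat) :
  computable F -> computable G -> computable (fun x => F x + G x).
Proof. exact (computable_binary _ _ _ _ reval_add). Qed.

Lemma computable_sub (F G : X -> nat) :
  computable F -> computable G -> computable (fun x => F x - G x).
Proof. exact (computable_binary _ _ _ _ reval_sub). Qed.

Lemma computable_nat_rect (a : X -> Y) (s : nat -> Y -> X -> Y) (c : X -> nat) :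
  computable a -> computable3 s -> computable c ->
  computable (fun x => nat_rect (fun _ => Y) (a x) (fun n y => s n y x) (c x)).
Proof.
  intros [ea Ha] [es Hs] [ec Hc].
  exists (RComp (RPrec ea (RComp es [RComp rf_pair [RComp rf_pair [RProj 0; RProj 1]; RProj 2]]))
            [ec; RProj 0]).
  intros x. pose proof reval_pair. reval. simpl.
  generalize (c x) as n. induction n as [|n IH]; [apply ev_prec0, Ha|].
  eapply ev_precS; [exact IH|]. reval.
  apply (Hs (n, nat_rect (fun _ => Y) (a x) (fun n y => s n y x) n, x)).
Qed.

Lemma computable_if (b : X -> bool) (f g : X -> Y) :
  computable b -> computable f -> computable g -> computable (fun x => if b x then f x else g x).
Proof.
  intros [eb Hb] [ef Hf] [eg Hg].
  exists (RComp (RPrec eg (RComp ef [RProj 2])) [eb; RProj 0]).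
  intros x. reval. simpl.
  destruct (b x); [|apply ev_prec0, Hg].
  eapply ev_precS; [apply ev_prec0, Hg|]. reval.
Qed.

(* The recursion on the code of [l x] is cut down to at most one step, so that [eg] is only
   run on codes. *)
Lemma computable_list_case (l : X -> list Y) (f : X -> Z) (g : Y -> list Y -> X -> Z) :
  computable l -> computable f -> computable3 g ->
  computable (fun x => match l x with [] => f x | y :: t => g y t x end).
Proof.
  intros [el Hl] [ef Hf] [eg Hg].
  exists (RComp (RPrec (RComp ef [RProj 0])
                  (RComp eg [RComp rf_pair [RComp rf_pred [RProj 3]; RProj 2]]))
            [RComp rf_sub [rf_one; RComp rf_sub [rf_one; el]]; RProj 0; el]).
  intros x. specialize (Hl x). pose proof reval_one. pose proof reval_sub.
  eapply ev_comp.
  { reval. }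
  simpl nth. destruct (l x) as [|y t].
  - apply ev_prec0. reval.
  - change (1 - (1 - code (y :: t))) with 1.
    eapply ev_precS; [apply ev_prec0; reval|].
    pose proof reval_pair. pose proof reval_pred. reval. apply (Hg (y, t, x)).
Qed.

Lemma computable_min (P : nat -> X -> bool) :
  computable2 P -> (forall x, exists n, P n x = true) ->
  exists m, computable m /\ forall x, P (m x) x = true.
Proof.
  intros [e He] HP.
  assert (Hleast : forall x, exists n, P n x = true /\ forall m, m < n -> P m x = false).
  { intros x. destruct (HP x) as [n Hn].
    destruct (dec_inh_nat_subset_has_unique_least_element (fun n => P n x = true))
      as (m & [Hm Hlt] & _); [|eauto|].
    - intros i. destruct (P i x); auto.
    - exists m. split; auto. intros i Hi. apply Bool.not_true_is_false. intros E.
      specialize (Hlt i E). lia. }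
  apply choice in Hleast as [m Hm]. exists m. split; [|apply Hm].
  exists (RMin (RComp rf_sub [rf_one; RComp e [rf_pair]])).
  intros x. destruct (Hm x) as [Em Hlt].
  assert (Htest : forall n, reval (RComp rf_sub [rf_one; RComp e [rf_pair]])
                [n; code x] (1 - code (P n x))).
  { intros n. pose proof reval_one. pose proof reval_sub. pose proof reval_pair.
    reval. apply (He (n, x)). }
  constructor.
  - specialize (Htest (m x)). now rewrite Em in Htest.
  - intros i Hi. exists 0. specialize (Htest i). now rewrite Hlt in Htest.
Qed.

End DataTypes.

(* Keeps [apply] from comparing functions through the codes of their values. *)
#[local] Opaque computable.

Lemma computable_comp2 {X Y Z W} `{coding X} `{coding Y} `{coding Z} `{coding W}
    (f : Y -> Z -> W) (g : X -> Y) (h : X -> Z) :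
  computable2 f -> computable g -> computable h -> computable (fun x => f (g x) (h x)).
Proof.
  intros Hf Hg Hh. exact (computable_comp _ _ Hf (computable_pair g h Hg Hh)).
Qed.

Lemma computable_comp3 {X Y Z V W} `{coding X} `{coding Y} `{coding Z} `{coding V} `{coding W}
    (f : Y -> Z -> V -> W) (g : X -> Y) (h : X -> Z) (k : X -> V) :
  computable3 f -> computable g -> computable h -> computable k ->
  computable (fun x => f (g x) (h x) (k x)).
Proof.
  intros Hf Hg Hh Hk.
  exact (computable_comp _ _ Hf (computable_pair _ k (computable_pair g h Hg Hh) Hk)).
Qed.

Ltac computability_extension := fail.

Ltac computability_step :=
  first
    [ eassumption
    | apply computable_id | apply computable_const | apply computable_fst
    | apply computable_snd | apply computable_succ | apply computable_pred
    | apply computable_add | apply computable_sub | apply computable_if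
    | match goal with
      | H : computable ?g |- computable (fun x => ?g (@?f x)) => apply (computable_comp g f H)
      | H : computable2 ?f |- computable (fun x => ?f (@?g x) (@?h x)) =>
          apply (computable_comp2 f g h H)
      | H : computable3 ?f |- computable (fun x => ?f (@?g x) (@?h x) (@?k x)) =>
          apply (computable_comp3 f g h k H)
      end
    | computability_extension
    | apply computable_pair ].

Ltac computability := cbn beta; repeat (computability_step; cbn beta).

Lemma computable_mul {X} `{coding X} (F G : X -> nat) :
  computable F -> computable G -> computable (fun x => F x * G x).
Proof.
  intros HF HG.
  apply computable_ext with (f := fun x => nat_rect (fun _ => nat) 0 (fun _ m => m + G x) (F x)).
  - intros x. induction (F x); simpl; lia.
  - apply (computable_nat_rect (fun _ => 0) (fun _ m x => m + G x)); computability.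
Qed.

Lemma computable_cons {X Y} `{coding X} `{coding Y} (f : X -> Y) (l : X -> list Y) :
  computable f -> computable l -> computable (fun x => f x :: l x).
Proof.
  intros Hf Hl.
  apply computable_via_code with (c := fun x => S (code (f x, l x))); [reflexivity|].
  apply computable_succ. exact (computable_pair f l Hf Hl).
Qed.

Lemma length_le_code {Y} `{coding Y} (l : list Y) : length l <= code l.
Proof.
  induction l as [|y l IH]; [auto|]. simpl in *.
  rewrite cpair_cantor. pose proof (Cantor.to_nat_non_decreasing (code y) (code l)).
  simpl in *. lia.
Qed.

Definition fold_left_step {Y Z} (f : Z -> Y -> Z) (s : list Y * Z) : list Y * Z :=
  match fst s with [] => s | y :: t => (t, f (snd s) y) end.

Lemma fold_left_iter {Y Z} (f : Z -> Y -> Z) n l a :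
  length l <= n -> Nat.iter n (fold_left_step f) (l, a) = ([], fold_left f l a).
Proof.
  revert l a. induction n as [|n IH]; intros [|y l] a L; simpl in L; try lia; auto.
  - rewrite Nat.iter_succ_r. apply (IH []). simpl. lia.
  - rewrite Nat.iter_succ_r. apply (IH l). lia.
Qed.

Lemma computable_fold_left {X Y Z} `{coding X} `{coding Y} `{coding Z}
    (f : Z -> Y -> X -> Z) (l : X -> list Y) (a : X -> Z) :
  computable3 f -> computable l -> computable a ->
  computable (fun x => fold_left (fun z y => f z y x) (l x) (a x)).
Proof.
  intros Hf Hl Ha.
  apply computable_ext with (f := fun x => snd
    (nat_rect (fun _ => (list Y * Z)%type) (l x, a x)
       (fun _ s => fold_left_step (fun z y => f z y x) s) (code (l x)))).
  { intros x.
    exact (f_equal snd (fold_left_iter (fun z y => f z y x) _ _ (a x) (length_le_code (l x)))). }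
  apply computable_snd, computable_nat_rect; [computability| |exact Hl].
  apply (computable_list_case (fun p => fst (snd (fst p))) (fun p => snd (fst p))
    (fun y t p => (t, f (snd (snd (fst p))) y (snd p)))); computability.
Qed.

Lemma computable_rev {X Y} `{coding X} `{coding Y} (l : X -> list Y) :
  computable l -> computable (fun x => rev (l x)).
Proof.
  intros Hl. apply computable_ext with (f := fun x => fold_left (fun t y => y :: t) (l x) []).
  - intros x. symmetry. rewrite rev_alt. generalize (@nil Y).
    induction (l x) as [|y t IH]; intros t'; [reflexivity | apply IH].
  - apply (computable_fold_left (fun t y _ => y :: t)); [|computability..].
    apply computable_cons; computability.
Qed.

Lemma computable_fold_right {X Y Z} `{coding X} `{coding Y} `{coding Z}
    (f : Y -> Z -> X -> Z) (a : X -> Z) (l : X -> list Y) :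
  computable3 f -> computable a -> computable l ->
  computable (fun x => fold_right (fun y z => f y z x) (a x) (l x)).
Proof.
  intros Hf Ha Hl.
  apply computable_ext with
    (f := fun x => fold_left (fun z y => f y z x) (rev (l x)) (a x)).
  { intros x. now rewrite <- fold_left_rev_right, rev_involutive. }
  apply (computable_fold_left (fun z y => f y z)); [|now apply computable_rev|exact Ha].
  computability.
Qed.

Lemma computable_length {X Y} `{coding X} `{coding Y} (l : X -> list Y) :
  computable l -> computable (fun x => length (l x)).
Proof.
  intros Hl. apply computable_ext with (f := fun x => fold_right (fun _ n => S n) 0 (l x)).
  - intros x. induction (l x); simpl; auto.
  - apply (computable_fold_right (fun _ n _ => S n)); computability.
Qed.

Lemma computable_app {X Y} `{coding X} `{coding Y} (l m : X -> list Y) :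
  computable l -> computable m -> computable (fun x => l x ++ m x).
Proof.
  intros Hl Hm. apply computable_ext with (f := fun x => fold_right cons (m x) (l x)).
  - intros x. induction (l x); simpl; congruence.
  - apply (computable_fold_right (fun y t _ => y :: t)); [|exact Hm|exact Hl].
    apply computable_cons; computability.
Qed.

Lemma computable_existsb {X Y} `{coding X} `{coding Y} (f : Y -> X -> bool) (l : X -> list Y) :
  computable2 f -> computable l ->
  computable (fun x => existsb (fun y => f y x) (l x)).
Proof.
  intros Hf Hl. apply computable_ext with
    (f := fun x => fold_right (fun y b => if f y x then true else b) false (l x)).
  - intros x. induction (l x) as [|y t IH]; simpl; [|destruct (f y x)]; auto.
  - apply (computable_fold_right (fun y b x => if f y x then true else b)); computability.
Qed.

Lemma computable_forallb {X Y} `{coding X} `{coding Y} (f : Y -> X -> bool) (l : X -> list Y) :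
  computable2 f -> computable l ->
  computable (fun x => forallb (fun y => f y x) (l x)).
Proof.
  intros Hf Hl. apply computable_ext with
    (f := fun x => fold_right (fun y b => if f y x then b else false) true (l x)).
  - intros x. induction (l x) as [|y t IH]; simpl; [|destruct (f y x)]; auto.
  - apply (computable_fold_right (fun y b x => if f y x then b else false)); computability.
Qed.

Lemma computable_skipn {X Y} `{coding X} `{coding Y} (n : X -> nat) (l : X -> list Y) :
  computable n -> computable l -> computable (fun x => skipn (n x) (l x)).
Proof.
  intros Hn Hl.
  apply computable_ext with
    (f := fun x => nat_rect (fun _ => list Y) (l x) (fun _ t => skipn 1 t) (n x)).
  - intros x. induction (n x) as [|i IH]; [reflexivity|]. cbn [nat_rect]. rewrite IH.
    apply skipn_skipn.
  - apply (computable_nat_rect l (fun _ t _ => skipn 1 t) n Hl); [|exact Hn].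
    apply (computable_list_case _ _ (fun y t _ => t)); computability.
Qed.

Lemma computable_flat_map {X Y Z} `{coding X} `{coding Y} `{coding Z}
    (f : Y -> X -> list Z) (l : X -> list Y) :
  computable2 f -> computable l ->
  computable (fun x => flat_map (fun y => f y x) (l x)).
Proof.
  intros Hf Hl. apply computable_ext with
    (f := fun x => fold_right (fun y t => f y x ++ t) [] (l x)).
  - intros x. induction (l x); simpl; congruence.
  - apply (computable_fold_right (fun y t x => f y x ++ t)); [|computability..].
    apply computable_app; computability.
Qed.

Lemma computable_map {X Y Z} `{coding X} `{coding Y} `{coding Z}
    (f : Y -> X -> Z) (l : X -> list Y) :
  computable2 f -> computable l ->
  computable (fun x => map (fun y => f y x) (l x)).
Proof.
  intros Hf Hl.
  apply computable_ext with (f := fun x => flat_map (fun y => [f y x]) (l x)).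
  - intros x. induction (l x); simpl; congruence.
  - apply computable_flat_map; [apply computable_cons|]; computability.
Qed.

Lemma computable_firstn {X Y} `{coding X} `{coding Y} (n : X -> nat) (l : X -> list Y) :
  computable n -> computable l -> computable (fun x => firstn (n x) (l x)).
Proof.
  intros Hn Hl.
  apply computable_ext with (f := fun x => rev (skipn (length (l x) - n x) (rev (l x)))).
  - intros x. symmetry. apply firstn_skipn_rev.
  - apply computable_rev, computable_skipn; [|now apply computable_rev].
    apply computable_sub; [now apply computable_length | exact Hn].
Qed.

Lemma computable_seq {X} `{coding X} (a n : X -> nat) :
  computable a -> computable n -> computable (fun x => seq (a x) (n x)).
Proof.
  intros Ha Hn. apply computable_ext with
    (f := fun x => nat_rect (fun _ => list nat) [] (fun i t => t ++ [a x + i]) (n x)).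
  - intros x. induction (n x) as [|i IH]; [reflexivity|]. now rewrite seq_S, <- IH.
  - apply (computable_nat_rect _ (fun i t x => t ++ [a x + i])); [computability| |exact Hn].
    apply computable_app; [computability|]. apply computable_cons; computability.
Qed.

Lemma computable_list_prod {X Y Z} `{coding X} `{coding Y} `{coding Z}
    (l : X -> list Y) (m : X -> list Z) :
  computable l -> computable m -> computable (fun x => list_prod (l x) (m x)).
Proof.
  intros Hl Hm.
  apply computable_ext with (f := fun x => flat_map (fun y => map (fun z => (y, z)) (m x)) (l x)).
  - intros x. symmetry. apply list_prod_as_flat_map.
  - apply (computable_flat_map (fun y x => map (fun z => (y, z)) (m x))); [|computability].
    apply (computable_map (fun z yx => (fst yx, z))); computability.
Qed.

Lemma computable_eq_zero {X} `{coding X} (F : X -> nat) :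
  computable F -> computable (fun x => F x =? 0).
Proof.
  intros HF.
  apply computable_ext with (f := fun x => nat_rect (fun _ => bool) true (fun _ _ => false) (F x)).
  - intros x. now destruct (F x).
  - apply (computable_nat_rect (fun _ => true) (fun _ _ _ => false)); computability.
Qed.

Lemma computable_ltb {X} `{coding X} (F G : X -> nat) :
  computable F -> computable G -> computable (fun x => F x <? G x).
Proof.
  intros HF HG. apply computable_ext with (f := fun x => S (F x) - G x =? 0).
  - intros x. apply Bool.eq_iff_eq_true. rewrite Nat.eqb_eq, Nat.ltb_lt. lia.
  - apply computable_eq_zero. computability.
Qed.

Lemma computable_list_max {X} `{coding X} (l : X -> list nat) :
  computable l -> computable (fun x => list_max (l x)).
Proof.
  intros Hl. apply (computable_fold_right (fun n m _ => Nat.max n m)); [|computability..].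
  apply computable_ext with (f := fun p => fst (fst p) + (snd (fst p) - fst (fst p))).
  - intros p. lia.
  - computability.
Qed.

Lemma in_le_list_max n l : In n l -> n <= list_max l.
Proof.
  pose proof (proj1 (list_max_le l _) (Nat.le_refl _)) as L. rewrite Forall_forall in L. apply L.
Qed.

Definition code_eqb {X} `{coding X} (x y : X) : bool := code x =? code y.

Lemma code_eqb_eq {X} `{coding X} (x y : X) : code_eqb x y = true <-> x = y.
Proof.
  unfold code_eqb. rewrite Nat.eqb_eq. split; [apply code_inj | now intros ->].
Qed.

Lemma computable_code_eqb {X Y} `{coding X} `{coding Y} (f g : X -> Y) :
  computable f -> computable g -> computable (fun x => code_eqb (f x) (g x)).
Proof.
  intros Hf Hg.
  apply (computable_via_code f (fun x => code (f x)) (fun _ => eq_refl)) in Hf.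
  apply (computable_via_code g (fun x => code (g x)) (fun _ => eq_refl)) in Hg.
  apply computable_ext with
    (f := fun x => code (f x) - code (g x) + (code (g x) - code (f x)) =? 0).
  - intros x. apply Bool.eq_iff_eq_true. unfold code_eqb. rewrite !Nat.eqb_eq. lia.
  - apply computable_eq_zero. computability.
Qed.

Ltac computability_extension ::=
  first
    [ apply computable_cons | apply computable_app | apply computable_length
    | apply computable_flat_map | apply computable_map | apply computable_existsb
    | apply computable_forallb | apply computable_firstn | apply computable_skipn
    | apply computable_list_prod | apply computable_seq | apply computable_list_max
    | apply computable_mul | apply computable_ltb | apply computable_code_eqb ].

Definition decidable {X} `{coding X} (P : X -> Prop) : Prop :=
  exists b : X -> bool, computable b /\ forall x, b x = true <-> P x.

Lemma decidable_code {X} `{coding X} (P : X -> Prop) :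
  (forall n, exists x : X, code x = n) ->
  decidable P <-> decidable_nat (fun n => exists x, n = code x /\ P x).
Proof.
  intros Hsurj.
  assert (Hcode : forall x, (exists y, code x = code y /\ P y) <-> P x).
  { intros x. split; [|now exists x]. intros (y & E & Hy). now apply code_inj in E as ->. }
  split.
  - intros (b & [e He] & Hb). exists e. intros n. destruct (Hsurj n) as [x <-].
    rewrite Hcode, <- Hb. specialize (He x). destruct (b x); split; easy.
  - intros [e He].
    exists (fun x => if excluded_middle_informative (P x) then true else false). split.
    + exists e. intros x. specialize (He (code x)). rewrite Hcode in He.
      destruct excluded_middle_informative; now apply He.
    + intros x. now destruct excluded_middle_informative.
Qed.

Lemma code_prod_surj {X Y} `{coding X} `{coding Y} :
  (forall n, exists x : X, code x = n) -> (forall n, exists y : Y, code y = n) ->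
  forall n, exists p : X * Y, code p = n.
Proof.
  intros HX HY n. destruct (HX (cfst n)) as [x Ex], (HY (csnd n)) as [y Ey].
  exists (x, y). simpl. now rewrite Ex, Ey, cpair_surj.
Qed.

Lemma code_list_surj {X} `{coding X} :
  (forall n, exists x : X, code x = n) -> forall n, exists l : list X, code l = n.
Proof.
  intros HX n. induction n as [[|n] IH] using lt_wf_ind; [now exists []|].
  destruct (HX (cfst n)) as [x Ex], (IH (csnd n)) as [l El].
  - pose proof (Cantor.to_nat_non_decreasing (cfst n) (csnd n)) as L.
    rewrite <- cpair_cantor, cpair_surj in L. lia.
  - exists (x :: l). simpl in *. now rewrite Ex, El, cpair_surj.
Qed.

Lemma solvable_word_problem_decidable k Rel :
  solvable_word_problem k Rel <->
  decidable (fun uv : list nat * list nat =>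
    letters_lt k (fst uv) /\ letters_lt k (snd uv) /\ rcong Rel (fst uv) (snd uv)).
Proof.
  rewrite decidable_code.
  - unfold solvable_word_problem, decidable_nat.
    enough (E : forall n, (exists u v, letters_lt k u /\ letters_lt k v /\
                  n = cpair (code_word u) (code_word v) /\ rcong Rel u v) <->
                (exists uv, n = code uv /\ letters_lt k (fst uv) /\ letters_lt k (snd uv) /\
                  rcong Rel (fst uv) (snd uv))) by now setoid_rewrite E.
    intros n. split.
    + intros (u & v & Hu & Hv & En & Huv). now exists (u, v).
    + intros ([u v] & En & Hu & Hv & Huv). now exists u, v.
  - apply code_prod_surj; apply code_list_surj; intros n; now exists n.
Qed.

(** * Derivations of bounded length *)

Inductive chain {X : Type} (R : X -> X -> Prop) : nat -> X -> X -> Prop :=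
| chain_refl n x : chain R n x x
| chain_step n x y z : chain R n x y -> R y z -> chain R (S n) x z.

Section Chain.
Context {X : Type} (R : X -> X -> Prop).

Lemma chain_one x y : R x y -> chain R 1 x y.
Proof. intros H. exact (chain_step R 0 x x y (chain_refl R 0 x) H). Qed.

Lemma chain_le n m x y : n <= m -> chain R n x y -> chain R m x y.
Proof.
  intros L H. revert m L. induction H as [|n x y z H IH Hs]; intros m L; [constructor|].
  destruct m as [|m]; [lia|]. econstructor; [apply IH; lia | exact Hs].
Qed.

Lemma chain_trans n m x y z : chain R n x y -> chain R m y z -> chain R (n + m) x z.
Proof.
  intros H H'. induction H' as [m y|m y z z' H' IH Hs].
  - apply (chain_le n); [lia | exact H].
  - rewrite Nat.add_succ_r. econstructor; eauto.
Qed.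

Lemma chain_sym n x y : (forall a b, R a b -> R b a) -> chain R n x y -> chain R n y x.
Proof.
  intros HR H. induction H as [|n x y z H IH Hs]; [constructor|].
  apply (chain_trans 1 n z y x); [apply chain_one; auto | exact IH].
Qed.

End Chain.

Lemma chain_map {X Y} (R : X -> X -> Prop) (R' : Y -> Y -> Prop) (f : X -> Y) n x y :
  (forall a b, R a b -> R' (f a) (f b)) -> chain R n x y -> chain R' n (f x) (f y).
Proof.
  intros Hf H. induction H as [|n x y z H IH Hs]; [constructor|]. econstructor; eauto.
Qed.

Lemma chain_mono {X} (R R' : X -> X -> Prop) n x y :
  (forall a b, R a b -> R' a b) -> chain R n x y -> chain R' n x y.
Proof. apply (chain_map R R' (fun a => a)). Qed.

Definition ball {X : Type} (next : X -> list X) (n : nat) (x : X) : list X :=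
  Nat.iter n (fun L => L ++ flat_map next L) [x].

Lemma in_ball {X} (next : X -> list X) n x y :
  In y (ball next n x) <-> chain (fun a b => In b (next a)) n x y.
Proof.
  split.
  - revert y. induction n as [|n IH]; intros y.
    + intros [<-|[]]. constructor.
    + simpl. rewrite in_app_iff, in_flat_map. intros [H|(z & Hz & Hy)].
      * apply (chain_le _ n); auto.
      * econstructor; [exact (IH z Hz) | exact Hy].
  - induction 1 as [n x|n x y z H IH Hs].
    + apply (Nat.iter_invariant n _ _ (fun L => In x L)); [|now left].
      intros L HL. apply in_app_iff. now left.
    + apply in_app_iff. right. apply in_flat_map. now exists y.
Qed.

Lemma computable_ball {X Y} `{coding X} `{coding Y}
    (next : Y -> list Y) (n : X -> nat) (a : X -> Y) :
  computable next -> computable n -> computable a -> computable (fun x => ball next (n x) (a x)).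
Proof.
  intros Hnext Hn Ha.
  apply (computable_nat_rect (fun x => [a x]) (fun _ L _ => L ++ flat_map next L));
    [computability| |exact Hn].
  apply computable_app; [|apply (computable_flat_map (fun y _ => next y))]; computability.
Qed.

Definition rules (Rel : list (list nat * list nat)) : list (list nat * list nat) :=
  Rel ++ map (fun lr => (snd lr, fst lr)) Rel.

Lemma in_rules Rel l r : In (l, r) (rules Rel) <-> In (l, r) Rel \/ In (r, l) Rel.
Proof.
  unfold rules. rewrite in_app_iff, in_map_iff. split; (intros [H|H]; [auto|]).
  - destruct H as [[a b] [E H]]. injection E as -> ->. auto.
  - right. now exists (r, l).
Qed.

Definition rewrite_step (Rel : list (list nat * list nat)) (u v : list nat) : Prop :=
  exists p l r s, In (l, r) (rules Rel) /\ u = p ++ l ++ s /\ v = p ++ r ++ s.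

Lemma rewrite_step_rule Rel l r : In (l, r) Rel -> rewrite_step Rel l r.
Proof.
  intros H. exists [], l, r, []. rewrite in_rules, !app_nil_r. auto.
Qed.

Lemma rewrite_step_sym Rel u v : rewrite_step Rel u v -> rewrite_step Rel v u.
Proof.
  intros (p & l & r & s & H & -> & ->). exists p, r, l, s.
  rewrite in_rules in *. tauto.
Qed.

Lemma rewrite_step_context Rel p s u v :
  rewrite_step Rel u v -> rewrite_step Rel (p ++ u ++ s) (p ++ v ++ s).
Proof.
  intros (p' & l & r & s' & H & -> & ->). exists (p ++ p'), l, r, (s' ++ s).
  now rewrite <- !app_assoc.
Qed.

Lemma chain_rewrite_step_context Rel n p s u v :
  chain (rewrite_step Rel) n u v -> chain (rewrite_step Rel) n (p ++ u ++ s) (p ++ v ++ s).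
Proof. apply (chain_map _ _ (fun w => p ++ w ++ s)). intros a b. apply rewrite_step_context. Qed.

Lemma rcong_chain Rel u v : rcong Rel u v <-> exists n, chain (rewrite_step Rel) n u v.
Proof.
  split.
  - induction 1 as [u|u v _ [n IH]|u v w _ [n IH] _ [m IH']|p l r s H].
    + exists 0. constructor.
    + exists n. apply chain_sym; auto using rewrite_step_sym.
    + exists (n + m). eapply chain_trans; eauto.
    + exists 1. apply chain_one, rewrite_step_context, rewrite_step_rule, H.
  - intros [n H]. induction H as [|n u v w _ IH (p & l & r & s & H & -> & ->)]; [constructor|].
    eapply rc_trans; [exact IH|]. apply in_rules in H. destruct H as [H|H].
    + now apply rc_step.
    + now apply rc_sym, rc_step.
Qed.

Definition rewrites (Rel : list (list nat * list nat)) (w : list nat) : list (list nat) :=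
  flat_map (fun i => flat_map (fun j => flat_map (fun lr =>
      if code_eqb w (firstn i w ++ fst lr ++ skipn j w)
      then [firstn i w ++ snd lr ++ skipn j w] else [])
    (rules Rel)) (seq 0 (S (length w)))) (seq 0 (S (length w))).

Lemma in_rewrites Rel u v : In v (rewrites Rel u) <-> rewrite_step Rel u v.
Proof.
  unfold rewrites. rewrite in_flat_map. setoid_rewrite in_flat_map.
  setoid_rewrite in_flat_map. split.
  - intros (i & _ & j & _ & [l r] & H & Hv). destruct code_eqb eqn:E; [|destruct Hv].
    apply (code_eqb_eq u) in E. destruct Hv as [<-|[]].
    now exists (firstn i u), l, r, (skipn j u).
  - intros (p & l & r & s & H & Eu & ->).
    assert (Ep : firstn (length p) u = p)
      by (rewrite Eu, firstn_app, firstn_all, Nat.sub_diag; apply app_nil_r).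
    assert (Es : skipn (length (p ++ l)) u = s)
      by now rewrite Eu, app_assoc, skipn_app, skipn_all, Nat.sub_diag.
    exists (length p). split; [apply in_seq; rewrite Eu, !length_app; lia|].
    exists (length (p ++ l)). split; [apply in_seq; rewrite Eu, !length_app; lia|].
    exists (l, r). rewrite Ep, Es. split; [exact H|].
    destruct code_eqb eqn:E; [now left|].
    apply Bool.not_true_iff_false in E. now rewrite code_eqb_eq in E.
Qed.

Lemma computable_rewrites Rel : computable (rewrites Rel).
Proof.
  apply (computable_flat_map (fun i w => flat_map (fun j => flat_map (fun lr =>
      if code_eqb w (firstn i w ++ fst lr ++ skipn j w)
      then [firstn i w ++ snd lr ++ skipn j w] else [])
    (rules Rel)) (seq 0 (S (length w))))); computability.
Qed.

Definition words (k n : nat) : list (list nat) :=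
  Nat.iter n (fun W => [] :: flat_map (fun w => map (fun i => i :: w) (seq 0 k)) W) [[]].

Lemma in_words k n w : In w (words k n) <-> letters_lt k w /\ length w <= n.
Proof.
  revert w. induction n as [|n IH]; intros w; simpl.
  - split.
    + intros [<-|[]]. split; [constructor | auto].
    + intros [_ L]. destruct w; [auto | simpl in L; lia].
  - rewrite in_flat_map. split.
    + intros [<-|(v & Hv & Hw)]; [split; [constructor | simpl; lia]|].
      apply in_map_iff in Hw as (i & <- & Hi%in_seq). apply IH in Hv as [Hv L].
      split; [constructor; [lia | exact Hv] | simpl; lia].
    + intros [[|i v Hi Hv] L]; [auto|]. right. exists v. simpl in L. split.
      * apply IH. split; [exact Hv | lia].
      * apply (in_map (fun j => j :: v)), in_seq. lia.
Qed.

Lemma computable_words {X} `{coding X} k (n : X -> nat) :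
  computable n -> computable (fun x => words k (n x)).
Proof.
  intros Hn. apply (computable_nat_rect (fun _ => [[]])
    (fun _ W _ => [] :: flat_map (fun w => map (fun i => i :: w) (seq 0 k)) W));
    computability.
Qed.

Definition letters_ltb (k : nat) (w : list nat) : bool := forallb (fun i => i <? k) w.

Lemma letters_ltb_lt k w : letters_ltb k w = true <-> letters_lt k w.
Proof.
  unfold letters_ltb, letters_lt. rewrite forallb_forall, Forall_forall.
  now setoid_rewrite Nat.ltb_lt.
Qed.

Lemma computable_letters_ltb k : computable (letters_ltb k).
Proof. apply (computable_forallb (fun i _ => i <? k)); computability. Qed.

Definition derivableb (Rel : list (list nat * list nat)) (n : nat) (u v : list nat) : bool :=
  existsb (code_eqb v) (ball (rewrites Rel) n u).

Lemma derivableb_chain Rel n u v : derivableb Rel n u v = true <-> chain (rewrite_step Rel) n u v.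
Proof.
  unfold derivableb. rewrite existsb_exists. setoid_rewrite code_eqb_eq.
  transitivity (In v (ball (rewrites Rel) n u)).
  - split; [intros (w & Hw & ->); exact Hw | intros Hv; now exists v].
  - rewrite in_ball. split; apply chain_mono; intros a b; apply in_rewrites.
Qed.

Lemma computable_derivableb {X} `{coding X} Rel (n : X -> nat) (u v : X -> list nat) :
  computable n -> computable u -> computable v ->
  computable (fun x => derivableb Rel (n x) (u x) (v x)).
Proof.
  intros Hn Hu Hv. pose proof (computable_rewrites Rel).
  apply (computable_existsb (fun w x => code_eqb (v x) w)); [computability|].
  now apply computable_ball.
Qed.

(** * Dehn functions and the word problem *)

Definition dehn_bound (k : nat) (Rel : list (list nat * list nat)) (T : nat -> nat) : Prop :=
  forall n u v, letters_lt k u -> letters_lt k v -> length u <= n -> length v <= n ->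
    rcong Rel u v -> chain (rewrite_step Rel) (T n) u v.

Lemma computable_dehn_bound_of_solvable k Rel :
  solvable_word_problem k Rel -> exists T, computable T /\ dehn_bound k Rel T.
Proof.
  intros (b & Hb & Eb)%solvable_word_problem_decidable.
  destruct (computable_min (fun n uv =>
      if b uv then derivableb Rel n (fst uv) (snd uv) else true)) as (m & Hm & Em).
  { apply computable_if; [computability | apply computable_derivableb | ]; computability. }
  { intros uv. destruct (b uv) eqn:E; [|now exists 0].
    apply Eb in E as (_ & _ & [n Hn]%rcong_chain). exists n. now apply derivableb_chain. }
  exists (fun n => list_max (map m (list_prod (words k n) (words k n)))). split.
  - pose proof (computable_words k (fun n => n) computable_id).
    apply computable_list_max, (computable_map (fun uv _ => m uv)); computability.
  - intros n u v Hu Hv Lu Lv Huv. specialize (Em (u, v)). cbn [fst snd] in Em.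
    rewrite (proj2 (Eb (u, v))), derivableb_chain in Em by auto.
    apply (chain_le _ (m (u, v))); [|exact Em].
    apply in_le_list_max, in_map, in_prod; now apply in_words.
Qed.

Lemma solvable_of_computable_dehn_bound k Rel T :
  computable T -> dehn_bound k Rel T -> solvable_word_problem k Rel.
Proof.
  intros HT HD. apply solvable_word_problem_decidable.
  exists (fun uv => if letters_ltb k (fst uv) then
                 if letters_ltb k (snd uv) then
                   derivableb Rel (T (length (fst uv) + length (snd uv))) (fst uv) (snd uv)
                 else false else false).
  split.
  - pose proof (computable_letters_ltb k).
    do 2 (apply computable_if; [computability| |computability]).
    apply computable_derivableb; computability.
  - intros [u v]. cbn [fst snd]. rewrite <- !letters_ltb_lt.
    destruct (letters_ltb k u) eqn:Hu; [|easy]. destruct (letters_ltb k v) eqn:Hv; [|easy].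
    rewrite derivableb_chain. split.
    + intros H. repeat split. apply rcong_chain. eauto.
    + intros (_ & _ & H). apply HD; [now apply letters_ltb_lt .. | lia | lia | exact H].
Qed.

(** * Paths in Cayley graphs *)

Lemma letters_app k u v : letters_lt k (u ++ v) <-> letters_lt k u /\ letters_lt k v.
Proof. apply Forall_app. Qed.

Lemma uniform_bound {X} (P : X -> nat -> Prop) (l : list X) :
  (forall x n m, n <= m -> P x n -> P x m) -> (forall x, In x l -> exists n, P x n) ->
  exists n, forall x, In x l -> P x n.
Proof.
  intros Hmono H. induction l as [|x l IH].
  - exists 0. intros x [].
  - destruct (H x) as [n Hn]; [now left|].
    destruct IH as [m Hm]; [intros y Hy; apply H; now right|].
    exists (n + m). intros y [<-|Hy].
    + apply (Hmono _ n); [lia | exact Hn].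
    + apply (Hmono _ m); [lia | now apply Hm].
Qed.

Local Infix "**" := (mmul _) (at level 40, left associativity).

Section Paths.
Context {M : monoid} (a : list M).

Definition act (x : M) (w : list nat) : M := x ** pres_eval M a w.

Lemma act_nil x : act x [] = x.
Proof. apply mulm1. Qed.

Lemma act_cons x i w : act x (i :: w) = act (x ** nth i a (munit M)) w.
Proof. apply massoc. Qed.

Lemma act_app x u v : act x (u ++ v) = act (act x u) v.
Proof.
  revert x. induction u as [|i u IH]; intros x; simpl app.
  - now rewrite act_nil.
  - now rewrite !act_cons.
Qed.

Lemma act_unit w : act (munit M) w = pres_eval M a w.
Proof. apply mul1m. Qed.

Lemma pres_eval_app u v : pres_eval M a (u ++ v) = pres_eval M a u ** pres_eval M a v.
Proof. now rewrite <- !(act_unit (u ++ v)), act_app, act_unit. Qed.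

Definition spans : Prop :=
  forall x, exists w, letters_lt (length a) w /\ pres_eval M a w = x.

Lemma spans_of_generates : generates M a -> spans.
Proof.
  intros Ha x. destruct (Ha x) as (w & Hw & <-).
  induction Hw as [|c w Hc _ (u & Hu & E)].
  - exists []. split; [constructor | reflexivity].
  - apply (In_nth _ _ (munit M)) in Hc as (i & Hi & <-).
    exists (i :: u). split; [now constructor|]. simpl. now rewrite <- E.
Qed.

Definition reach (x y : M) (n : nat) : Prop :=
  exists w, letters_lt (length a) w /\ act x w = y /\ length w <= n.

Lemma reach_le x y n m : n <= m -> reach x y n -> reach x y m.
Proof. intros L (w & Hw & E & Lw). exists w. repeat split; auto. lia. Qed.

Lemma reach_trans x y z n m : reach x y n -> reach y z m -> reach x z (n + m).
Proof.
  intros (u & Hu & <- & Lu) (v & Hv & <- & Lv). exists (u ++ v).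
  rewrite letters_app, act_app, length_app. repeat split; auto. lia.
Qed.

Definition cell_move (C : nat) (x : M) (u v : list nat) : Prop :=
  exists p l r s, u = p ++ l ++ s /\ v = p ++ r ++ s /\
    length l <= C /\ length r <= C /\
    letters_lt (length a) l /\ letters_lt (length a) r /\
    act x (p ++ l) = act x (p ++ r).

Lemma cell_move_short C x l r :
  length l <= C -> length r <= C -> letters_lt (length a) l -> letters_lt (length a) r ->
  act x l = act x r -> cell_move C x l r.
Proof. intros. exists [], l, r, []. rewrite !app_nil_r. auto 8. Qed.

Lemma cell_move_sym C x u v : cell_move C x u v -> cell_move C x v u.
Proof. intros (p & l & r & s & H). exists p, r, l, s. intuition congruence. Qed.

Lemma cell_move_le C C' x u v : C <= C' -> cell_move C x u v -> cell_move C' x u v.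
Proof. intros L (p & l & r & s & H). exists p, l, r, s. intuition lia. Qed.

Lemma cell_move_context C x q u v t :
  cell_move C (act x q) u v -> cell_move C x (q ++ u ++ t) (q ++ v ++ t).
Proof.
  intros (p & l & r & s & -> & -> & H). exists (q ++ p), l, r, (s ++ t).
  rewrite <- !app_assoc, !(act_app x q). auto.
Qed.

Lemma cell_move_letters C x u v :
  cell_move C x u v -> letters_lt (length a) u -> letters_lt (length a) v.
Proof.
  intros (p & l & r & s & -> & -> & _ & _ & _ & Hr & _). rewrite !letters_app. tauto.
Qed.

Lemma cell_move_length C x u v : cell_move C x u v -> length v <= length u + C.
Proof.
  intros (p & l & r & s & -> & -> & _ & Hr & _). rewrite !length_app. lia.
Qed.

Lemma chain_cell_move_le C C' x n u v :
  C <= C' -> chain (cell_move C x) n u v -> chain (cell_move C' x) n u v.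
Proof. intros L. apply chain_mono. intros u' v'. now apply cell_move_le. Qed.

Lemma chain_cell_move_context C x q n u v t :
  chain (cell_move C (act x q)) n u v -> chain (cell_move C x) n (q ++ u ++ t) (q ++ v ++ t).
Proof. apply (chain_map _ _ (fun w => q ++ w ++ t)). intros u' v'. apply cell_move_context. Qed.

Lemma chain_cell_move_prefix C x q n u v :
  chain (cell_move C (act x q)) n u v -> chain (cell_move C x) n (q ++ u) (q ++ v).
Proof.
  intros H. apply (chain_cell_move_context _ _ _ _ _ _ []) in H. now rewrite !app_nil_r in H.
Qed.

Lemma chain_cell_move_letters C x n u v :
  chain (cell_move C x) n u v -> letters_lt (length a) u -> letters_lt (length a) v.
Proof. induction 1; eauto using cell_move_letters. Qed.

Lemma chain_cell_move_length C x n u v :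
  chain (cell_move C x) n u v -> length v <= length u + n * C.
Proof.
  induction 1 as [n u|n u v w _ IH H]; [lia|]. apply cell_move_length in H. lia.
Qed.

Definition homotopy_bound (C : nat) (x : M) (T : nat -> nat) : Prop :=
  forall n u v, letters_lt (length a) u -> letters_lt (length a) v ->
    length u <= n -> length v <= n -> act x u = act x v -> chain (cell_move C x) (T n) u v.

(* Paths from [y] are extended by [q] to paths from [x]; the return path [s] turns this into a
   detour through the loop [s ++ q], which is contracted by a single move. *)
Lemma homotopy_bound_basepoint C x y q s T :
  letters_lt (length a) q -> letters_lt (length a) s -> act x q = y -> act y s = x ->
  homotopy_bound C x T ->
  homotopy_bound (C + length s + length q) y (fun n => T (length q + n) + 2).
Proof.
  intros Hq Hs Exy Eyx HT n u v Hu Hv Lu Lv E.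
  set (C' := C + length s + length q).
  assert (Detour : forall w, cell_move C' y w (s ++ q ++ w)).
  { intros w. rewrite app_assoc. apply (cell_move_context C' y [] [] (s ++ q) w).
    rewrite act_nil. apply cell_move_short.
    - simpl. lia.
    - rewrite length_app. unfold C'. lia.
    - constructor.
    - now apply letters_app.
    - now rewrite act_app, Eyx, act_nil, Exy. }
  replace (T (length q + n) + 2) with (1 + T (length q + n) + 1) by lia.
  apply chain_trans with (s ++ q ++ v); [apply chain_trans with (s ++ q ++ u)|].
  - apply chain_one, Detour.
  - apply (chain_cell_move_le C); [unfold C'; lia|]. apply chain_cell_move_prefix. rewrite Eyx.
    apply HT; rewrite ?letters_app, ?length_app, ?act_app, ?Exy; auto; lia.
  - apply chain_one, cell_move_sym, Detour.
Qed.

End Paths.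

Definition lipschitz {M N : monoid} (a : list M) (b : list N) (f : M -> N) (K : nat) : Prop :=
  forall x c, In c a -> reach b (f x) (f (x ** c)) K.

Lemma lipschitz_le {M N : monoid} (a : list M) (b : list N) f K K' :
  K <= K' -> lipschitz a b f K -> lipschitz a b f K'.
Proof. intros L Hf x c Hc. apply (reach_le _ _ _ K); auto. Qed.

(** * Quasi-isometries in terms of paths *)

Lemma mprod_app (M : monoid) u v : mprod M (u ++ v) = mprod M u ** mprod M v.
Proof.
  induction u as [|c u IH]; simpl; [now rewrite mul1m|]. now rewrite IH, massoc.
Qed.

Lemma dist_le_trans (M : monoid) A x y z r s :
  dist_le M A x y r -> dist_le M A y z s -> dist_le M A x z (r + s).
Proof.
  intros (u & Hu & <- & Lu) (v & Hv & <- & Lv). exists (u ++ v). split; [|split].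
  - now apply Forall_app.
  - rewrite mprod_app. apply massoc.
  - rewrite length_app, plus_INR. lra.
Qed.

Lemma generates_dist_le (M : monoid) A c :
  generates M A -> exists n, forall x, dist_le M A x (x ** c) (INR n).
Proof.
  intros HA. destruct (HA c) as (w & Hw & <-). exists (length w). intros x. exists w.
  repeat split; auto. apply Rle_refl.
Qed.

Lemma generates_dist_le_uniform (M : monoid) A (a : list M) :
  generates M A -> exists n, forall c, In c a -> forall x, dist_le M A x (x ** c) (INR n).
Proof.
  intros HA. apply (uniform_bound (fun c n => forall x, dist_le M A x (x ** c) (INR n))).
  - intros c n m L H x. destruct (H x) as (w & Hw & E & Lw). exists w. repeat split; auto.
    apply le_INR in L. lra.
  - intros c _. now apply generates_dist_le.
Qed.

Lemma reach_of_dist_le (M : monoid) (a : list M) A r :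
  spans a -> exists K, forall x y, dist_le M A x y r -> reach a x y K.
Proof.
  intros Ha.
  destruct (uniform_bound (fun c n => forall x, reach a x (x ** c) n) A) as [n Hn].
  { intros c n m L H x. apply (reach_le a x _ n); auto. }
  { intros c _. destruct (Ha c) as (w & Hw & <-). exists (length w). intros x. exists w. auto. }
  destruct (INR_unbounded r) as [m Hm]. exists (m * n). intros x y (w & Hw & <- & L).
  apply (reach_le a x _ (length w * n)).
  - apply Nat.mul_le_mono_r, INR_le. lra.
  - clear L. revert x. induction Hw as [|d w Hd _ IH]; intros x; simpl.
    + rewrite mulm1. exists []. rewrite act_nil. repeat split; constructor.
    + rewrite massoc. eapply reach_trans; [exact (Hn d Hd x) | apply IH].
Qed.

Lemma quasi_isometry_lipschitz {M N : monoid} A B f (a : list M) (b : list N) :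
  generates M A -> generates N B -> quasi_isometry M N A B f -> spans a -> spans b ->
  exists (g : N -> M) (K : nat),
    lipschitz a b f K /\ lipschitz b a g K /\
    (forall y, reach b y (f (g y)) K) /\ (forall y, reach b (f (g y)) y K) /\
    reach a (g (munit N)) (munit M) K.
Proof.
  intros HA HB (lam & eps & mu & _ & _ & _ & Hup & Hlow & Hdense) Ha Hb.
  destruct (choice _ Hdense) as [g Hg].
  destruct (generates_dist_le_uniform M A a HA) as [m Hm].
  destruct (generates_dist_le_uniform N B b HB) as [n Hn].
  destruct (generates_dist_le N B (f (munit M)) HB) as [d Hd].
  specialize (Hd (munit N)). rewrite mul1m in Hd.
  destruct (reach_of_dist_le N b B (lam * INR m + eps) Hb) as [Kf HKf].
  destruct (reach_of_dist_le M a A (lam * (mu + INR n + mu + eps)) Ha) as [Kg HKg].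
  destruct (reach_of_dist_le N b B mu Hb) as [Kfg HKfg].
  destruct (reach_of_dist_le M a A (lam * (mu + INR d + eps)) Ha) as [Kunit HKunit].
  exists g, (Kf + Kg + Kfg + Kunit). repeat split.
  - apply (lipschitz_le _ _ _ Kf); [lia|]. intros x c Hc. now apply HKf, Hup, Hm.
  - apply (lipschitz_le _ _ _ Kg); [lia|]. intros y c Hc. apply HKg, Hlow.
    eapply dist_le_trans; [eapply dist_le_trans|]; [apply Hg | apply Hn, Hc | apply Hg].
  - intros y. apply (reach_le _ _ _ Kfg); [lia|]. apply HKfg, Hg.
  - intros y. apply (reach_le _ _ _ Kfg); [lia|]. apply HKfg, Hg.
  - apply (reach_le _ _ _ Kunit); [lia|]. apply HKunit, Hlow.
    eapply dist_le_trans; [apply Hg | exact Hd].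
Qed.

Record path_map {M N : monoid} (a : list M) (b : list N) (f : M -> N) (K : nat)
    (F : M -> list nat -> list nat) : Prop := {
  path_map_app : forall x u v, F x (u ++ v) = F x u ++ F (act a x u) v;
  path_map_letters : forall x w, letters_lt (length b) (F x w);
  path_map_length : forall x w, length (F x w) <= length w * K;
  path_map_act : forall x w, act b (f x) (F x w) = f (act a x w) }.

Arguments path_map_app {M N a b f K F}.
Arguments path_map_letters {M N a b f K F}.
Arguments path_map_length {M N a b f K F}.
Arguments path_map_act {M N a b f K F}.

Lemma lipschitz_path_map {M N : monoid} (a : list M) (b : list N) f K :
  lipschitz a b f K -> exists F, path_map a b f K F.
Proof.
  intros Hf.
  destruct (choice (fun (xi : M * nat) w => letters_lt (length b) w /\
    act b (f (fst xi)) w = f (fst xi ** nth (snd xi) a (munit M)) /\ length w <= K))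
    as [phi Hphi].
  { intros [x i]. simpl. destruct (nth_in_or_default i a (munit M)) as [Hi| ->].
    - now apply Hf.
    - exists []. rewrite act_nil, mulm1. repeat split; [constructor | simpl; lia]. }
  set (F := fix F x w := match w with
                         | [] => []
                         | i :: w' => phi (x, i) ++ F (x ** nth i a (munit M)) w'
                         end).
  exists F. split.
  - intros x u v. revert x. induction u as [|i u IH]; intros x; simpl.
    + now rewrite act_nil.
    + now rewrite IH, act_cons, app_assoc.
  - intros x w. revert x. induction w as [|i w IH]; intros x; simpl; [constructor|].
    apply letters_app. split; [apply Hphi | apply IH].
  - intros x w. revert x. induction w as [|i w IH]; intros x; simpl; [lia|].
    destruct (Hphi (x, i)) as (_ & _ & L). rewrite length_app.
    specialize (IH (x ** nth i a (munit M))). lia.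
  - intros x w. revert x. induction w as [|i w IH]; intros x; simpl; [now rewrite !act_nil|].
    destruct (Hphi (x, i)) as (_ & E & _). simpl in E. now rewrite act_app, act_cons, E.
Qed.

Lemma cell_move_path_map {M N : monoid} (a : list M) (b : list N) f K F C x u v :
  path_map a b f K F -> cell_move a C x u v -> cell_move b (C * K) (f x) (F x u) (F x v).
Proof.
  intros [Happ Hletters Hlength Hact] (p & l & r & s & -> & -> & Ll & Lr & _ & _ & E).
  exists (F x p), (F (act a x p) l), (F (act a x p) r), (F (act a x (p ++ l)) s).
  pose proof (Hlength (act a x p) l). pose proof (Hlength (act a x p) r).
  repeat split; auto; try nia.
  - now rewrite !Happ, act_app.
  - now rewrite !Happ, E, act_app.
  - now rewrite <- !Happ, !Hact, E.
Qed.

Section RoundTrip.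
Context {M N : monoid} (a : list M) (b : list N) (f : M -> N) (g : N -> M) (K : nat).
Context (F : M -> list nat -> list nat) (G : N -> list nat -> list nat).
Hypothesis HF : path_map a b f K F.
Hypothesis HG : path_map b a g K G.
Context (rung_out rung_back : N -> list nat).
Hypothesis rung_out_spec : forall y, letters_lt (length b) (rung_out y) /\
  act b y (rung_out y) = f (g y) /\ length (rung_out y) <= K.
Hypothesis rung_back_spec : forall y, letters_lt (length b) (rung_back y) /\
  act b (f (g y)) (rung_back y) = y /\ length (rung_back y) <= K.

Definition round_trip (y : N) (w : list nat) : list nat :=
  rung_out y ++ F (g y) (G y w) ++ rung_back (act b y w).

Lemma cell_move_round_trip_cons i y w :
  i < length b ->
  cell_move b (1 + 2 * K + K * K) y (i :: round_trip (act b y [i]) w) (round_trip y (i :: w)).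
Proof.
  intros Hi. set (y' := act b y [i]).
  unfold round_trip. change (i :: w) with ([i] ++ w).
  rewrite (path_map_app HG), (path_map_app HF), act_app.
  rewrite (path_map_act HG). fold y'.
  destruct (rung_out_spec y) as (Lo & Eo & No), (rung_out_spec y') as (Lo' & Eo' & No').
  exists [], (i :: rung_out y'), (rung_out y ++ F (g y) (G y [i])),
    (F (g y') (G y' w) ++ rung_back (act b y' w)).
  split; [reflexivity|]. split; [now rewrite <- !app_assoc|]. repeat split.
  - simpl. lia.
  - rewrite length_app. pose proof (path_map_length HF (g y) (G y [i])).
    pose proof (path_map_length HG y [i]) as L. simpl in L. nia.
  - now constructor.
  - apply letters_app. split; [exact Lo | apply (path_map_letters HF)].
  - change (act b y ([i] ++ rung_out y') = act b y (rung_out y ++ F (g y) (G y [i]))).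
    rewrite !act_app. fold y'. rewrite Eo, Eo'.
    now rewrite (path_map_act HF), (path_map_act HG).
Qed.

(* A ladder whose rungs are the paths [rung_out]. *)
Lemma chain_round_trip w y :
  letters_lt (length b) w ->
  chain (cell_move b (1 + 2 * K + K * K) y) (S (length w)) w (round_trip y w).
Proof.
  revert y. induction w as [|i w IH]; intros y Hw.
  - destruct (rung_out_spec y) as (Lo & Eo & No), (rung_back_spec y) as (Lb & Eb & Nb).
    pose proof (path_map_length HF (g y) (G y [])).
    pose proof (path_map_length HG y []) as L. simpl in L.
    apply chain_one, cell_move_short; unfold round_trip.
    + simpl. lia.
    + rewrite !length_app, act_nil. nia.
    + constructor.
    + rewrite act_nil, !letters_app. repeat split; auto. apply (path_map_letters HF).
    + rewrite !act_app, Eo, (path_map_act HF), (path_map_act HG).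
      now rewrite act_nil.
  - apply chain_step with (i :: round_trip (act b y [i]) w).
    + apply (chain_cell_move_prefix b _ y [i]), IH. now inversion Hw.
    + apply cell_move_round_trip_cons. now inversion Hw.
Qed.

Lemma homotopy_bound_round_trip C T y :
  homotopy_bound a C (g y) T ->
  homotopy_bound b (1 + 2 * K + K * K + C * K) y (fun n => T (n * K) + 2 * n + 2).
Proof.
  intros HT n u v Hu Hv Lu Lv E. set (C' := 1 + 2 * K + K * K + C * K).
  assert (Ladder : forall w, letters_lt (length b) w -> length w <= n ->
            chain (cell_move b C' y) (S n) w (round_trip y w)).
  { intros w Hw Lw. apply (chain_cell_move_le b (1 + 2 * K + K * K)); [unfold C'; lia|].
    apply (chain_le _ (S (length w))); [lia | now apply chain_round_trip]. }
  assert (HM : chain (cell_move a C (g y)) (T (n * K)) (G y u) (G y v)).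
  { destruct HG as [_ Hletters Hlength Hact].
    pose proof (Hlength y u). pose proof (Hlength y v).
    apply HT; auto; [nia | nia |]. now rewrite !Hact, E. }
  replace (T (n * K) + 2 * n + 2) with (S n + T (n * K) + S n) by lia.
  apply chain_trans with (round_trip y v); [apply chain_trans with (round_trip y u)|].
  - now apply Ladder.
  - unfold round_trip. rewrite E. apply chain_cell_move_context.
    destruct (rung_out_spec y) as (_ & -> & _).
    apply (chain_cell_move_le b (C * K)); [unfold C'; lia|].
    revert HM. apply chain_map. intros u' v'. now apply cell_move_path_map.
  - apply chain_sym; [intros; now apply cell_move_sym | now apply Ladder].
Qed.

End RoundTrip.

Lemma homotopy_bound_quasi_isometry {M N : monoid} A B f (a : list M) (b : list N) C T :
  generates M A -> generates N B -> quasi_isometry M N A B f -> spans a -> spans b ->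
  homotopy_bound a C (munit M) T ->
  exists C' c K, homotopy_bound b C' (munit N) (fun n => T (c + n * K) + 2 * n + 4).
Proof.
  intros HA HB Hqi Ha Hb HT.
  destruct (quasi_isometry_lipschitz A B f a b HA HB Hqi Ha Hb)
    as (g & K & Hf & Hg & Hout & Hback & (s & Hs & Es & _)).
  destruct (lipschitz_path_map a b f K Hf) as [F HF].
  destruct (lipschitz_path_map b a g K Hg) as [G HG].
  destruct (choice _ Hout) as [rung_out Hrung_out].
  destruct (choice _ Hback) as [rung_back Hrung_back].
  destruct (Ha (g (munit N))) as (q & Hq & Eq). rewrite <- act_unit in Eq.
  pose proof (homotopy_bound_basepoint a C _ _ q s T Hq Hs Eq Es HT) as HT'.
  apply (homotopy_bound_round_trip a b f g K F G HF HG _ _ Hrung_out Hrung_back) in HT'.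
  eexists _, (length q), K. intros n u v Hu Hv Lu Lv E.
  eapply chain_le; [|exact (HT' n u v Hu Hv Lu Lv E)]. simpl. lia.
Qed.

(** * Finite presentations from bounded homotopies *)

Definition principal_left_ideal {N : monoid} (x : N) : N -> Prop :=
  fun y => exists m, y = m ** x.

Lemma finitely_many_left_ideals_representatives (N : monoid) :
  finitely_many N (left_ideal N) ->
  exists Y : list N, forall x, exists y, In y Y /\
    principal_left_ideal y x /\ principal_left_ideal x y.
Proof.
  intros [L HL].
  set (generator J := epsilon (inhabits (munit N))
         (fun y => forall z, principal_left_ideal y z <-> J z)).
  exists (map generator L). intros x.
  destruct (HL (principal_left_ideal x)) as (J & HJ & Ex).
  { intros m z [m' ->]. exists (m ** m'). apply massoc. }
  exists (generator J). split; [now apply in_map|].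
  assert (Ey : forall z, principal_left_ideal (generator J) z <-> J z)
    by (apply (epsilon_spec (inhabits (munit N))); now exists x).
  assert (Hrefl : forall z, principal_left_ideal z z)
    by (intros z; exists (munit N); now rewrite mul1m).
  split; [apply Ey, Ex | apply Ex, Ey]; apply Hrefl.
Qed.

Section TrueRelations.
Context {N : monoid} (b : list N).

(* As [w] and [q ++ y] have the same value, the last condition puts the values of [w] and [y]
   in one L-class. *)
Definition has_short_suffix (D L : nat) (w : list nat) : Prop :=
  exists q y, letters_lt (length b) q /\ letters_lt (length b) y /\ length y <= D /\
    length (q ++ y) <= L /\ pres_eval N b w = pres_eval N b (q ++ y) /\
    principal_left_ideal (pres_eval N b w) (pres_eval N b y).

Lemma has_short_suffix_le D D' L L' w :
  D <= D' -> L <= L' -> has_short_suffix D L w -> has_short_suffix D' L' w.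
Proof.
  intros HD HL (q & y & H). exists q, y. intuition lia.
Qed.

Lemma finitely_many_left_ideals_short_suffix :
  spans b -> finitely_many N (left_ideal N) ->
  exists D, forall w, exists L, has_short_suffix D L w.
Proof.
  intros Hb (Y & HY)%finitely_many_left_ideals_representatives.
  destruct (uniform_bound (fun y D => exists w, letters_lt (length b) w /\ length w <= D /\
              pres_eval N b w = y) Y) as [D HD].
  { intros y n m L (w & Hw & Lw & E). exists w. repeat split; auto. lia. }
  { intros y _. destruct (Hb y) as (w & Hw & E). exists (length w), w. auto. }
  exists D. intros w. destruct (HY (pres_eval N b w)) as (y & Hy & [m Em] & H).
  destruct (HD y Hy) as (v & Hv & Lv & <-). destruct (Hb m) as (q & Hq & <-).
  exists (length (q ++ v)), q, v. rewrite pres_eval_app. auto 7.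
Qed.

Lemma finitely_many_left_ideals_bounded_suffix :
  spans b -> finitely_many N (left_ideal N) ->
  exists D L, forall w, letters_lt (length b) w -> length w <= S D -> has_short_suffix D L w.
Proof.
  intros Hb HN. destruct (finitely_many_left_ideals_short_suffix Hb HN) as [D HD].
  destruct (uniform_bound (fun w L => has_short_suffix D L w) (words (length b) (S D)))
    as [L HL].
  - intros w n m Lnm. now apply has_short_suffix_le.
  - intros w _. apply HD.
  - exists D, L. intros w Hw Lw. now apply HL, in_words.
Qed.

Definition true_relations (L : nat) : list (list nat * list nat) :=
  filter (fun lr => if excluded_middle_informative
                      (pres_eval N b (fst lr) = pres_eval N b (snd lr)) then true else false)
    (list_prod (words (length b) L) (words (length b) L)).

Lemma in_true_relations L l r :
  In (l, r) (true_relations L) <->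
  (letters_lt (length b) l /\ length l <= L) /\ (letters_lt (length b) r /\ length r <= L) /\
  pres_eval N b l = pres_eval N b r.
Proof.
  unfold true_relations. rewrite filter_In, in_prod_iff, !in_words. simpl fst. simpl snd.
  destruct excluded_middle_informative; intuition congruence.
Qed.

Lemma rcong_true_relations_eval L u v :
  rcong (true_relations L) u v -> pres_eval N b u = pres_eval N b v.
Proof.
  induction 1 as [u|u v _ IH|u v w _ IHu _ IHv|p l r s H]; try congruence.
  apply in_true_relations in H as (_ & _ & E). rewrite !pres_eval_app. congruence.
Qed.

Variables (C D L : nat).
Hypothesis D_lt_L : D < L.
Hypothesis DC_le_L : D + C <= L.
Hypothesis short_suffix :
  forall w, letters_lt (length b) w -> length w <= S D -> has_short_suffix D L w.

Lemma chain_short_suffix p :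
  letters_lt (length b) p ->
  exists q y, letters_lt (length b) y /\ length y <= D /\
    chain (rewrite_step (true_relations L)) (S (length p)) p (q ++ y) /\
    principal_left_ideal (pres_eval N b p) (pres_eval N b y).
Proof.
  assert (Hreduce : forall w, letters_lt (length b) w -> length w <= S D ->
    exists q y, letters_lt (length b) y /\ length y <= D /\
      rewrite_step (true_relations L) w (q ++ y) /\
      principal_left_ideal (pres_eval N b w) (pres_eval N b y)).
  { intros w Hw Lw. destruct (short_suffix w Hw Lw) as (q & y & Hq & Hy & Ly & Lqy & E & H).
    exists q, y. repeat split; auto. apply rewrite_step_rule, in_true_relations.
    rewrite letters_app. repeat split; auto. lia. }
  induction p as [|i p IH] using rev_ind; intros Hp.
  - destruct (Hreduce []) as (q & y & Hy & Ly & Hqy & H); [constructor | simpl; lia|].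
    exists q, y. repeat split; auto. now apply chain_one.
  - apply letters_app in Hp as [Hp Hi]. destruct (IH Hp) as (q & y & Hy & Ly & Hc & [m Em]).
    destruct (Hreduce (y ++ [i])) as (q' & y' & Hy' & Ly' & Hs & [m' Em']).
    { now apply letters_app. }
    { rewrite length_app. simpl. lia. }
    exists (q ++ q'), y'. repeat split; auto.
    + rewrite length_app, Nat.add_1_r. apply chain_step with (q ++ y ++ [i]).
      * rewrite app_assoc. now apply (chain_rewrite_step_context _ _ [] [i]).
      * rewrite <- app_assoc. apply (rewrite_step_context _ q []) in Hs.
        now rewrite !app_nil_r in Hs.
    + exists (m' ** m). rewrite Em', !pres_eval_app, Em. now rewrite !massoc.
Qed.

Lemma cell_move_derivable u v :
  letters_lt (length b) u -> cell_move b C (munit N) u v ->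
  chain (rewrite_step (true_relations L)) (2 * length u + 3) u v.
Proof.
  intros Hu (p & l & r & s & -> & -> & Ll & Lr & Hl & Hr & E).
  apply letters_app in Hu as [Hp _].
  destruct (chain_short_suffix p Hp) as (q & y & Hy & Ly & Hc & [m Em]).
  assert (Hpq : forall t, chain (rewrite_step (true_relations L)) (S (length p))
                  (p ++ t ++ s) (q ++ y ++ t ++ s)).
  { intros t. rewrite (app_assoc q). now apply (chain_rewrite_step_context _ _ [] (t ++ s)). }
  apply (chain_le _ (S (length p) + 1 + S (length p))); [rewrite length_app; lia|].
  apply chain_trans with (q ++ y ++ r ++ s); [apply chain_trans with (q ++ y ++ l ++ s)|].
  - apply Hpq.
  - apply chain_one. rewrite (app_assoc y), (app_assoc y).
    apply rewrite_step_context, rewrite_step_rule.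
    apply in_true_relations. rewrite !letters_app, !length_app. repeat split; auto; try lia.
    rewrite !act_unit, !pres_eval_app in E. rewrite !pres_eval_app, Em, <- !massoc. congruence.
  - apply chain_sym; [intros; now apply rewrite_step_sym | apply Hpq].
Qed.

Lemma chain_cell_move_derivable n u v :
  letters_lt (length b) u -> chain (cell_move b C (munit N)) n u v ->
  chain (rewrite_step (true_relations L)) (n * (2 * (length u + n * C) + 3)) u v.
Proof.
  intros Hu H. induction H as [n u|n u v w H IH Hs]; [constructor|].
  pose proof (chain_cell_move_length b C _ n u v H).
  apply (chain_le _ (n * (2 * (length u + n * C) + 3) + (2 * length v + 3))); [nia|].
  eapply chain_trans; [now apply IH | apply cell_move_derivable; [|exact Hs]].
  now apply (chain_cell_move_letters b C (munit N) n u).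
Qed.

Lemma true_relations_presentation T :
  spans b -> homotopy_bound b C (munit N) T ->
  is_finite_presentation N b (true_relations L) /\
  dehn_bound (length b) (true_relations L) (fun n => T n * (2 * (n + T n * C) + 3)).
Proof.
  intros Hb HT.
  assert (Hderiv : forall n u v, letters_lt (length b) u -> letters_lt (length b) v ->
    length u <= n -> length v <= n -> pres_eval N b u = pres_eval N b v ->
    chain (rewrite_step (true_relations L)) (T n * (2 * (n + T n * C) + 3)) u v).
  { intros n u v Hu Hv Lu Lv E. apply (chain_le _ (T n * (2 * (length u + T n * C) + 3))).
    - apply Nat.mul_le_mono_l. lia.
    - apply chain_cell_move_derivable; [exact Hu|]. apply HT; auto. now rewrite !act_unit. }
  split; [split; [|split; [exact Hb|]]|].
  - apply Forall_forall. intros [l r] H. apply in_true_relations in H. simpl. tauto.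
  - intros u v Hu Hv. split; [|apply rcong_true_relations_eval]. intros E. apply rcong_chain.
    eexists. apply (Hderiv (length u + length v)); auto; lia.
  - intros n u v Hu Hv Lu Lv H. apply Hderiv; auto. now apply rcong_true_relations_eval in H.
Qed.

End TrueRelations.

Lemma presentation_of_homotopy_bound {N : monoid} (b : list N) C T :
  spans b -> finitely_many N (left_ideal N) -> homotopy_bound b C (munit N) T ->
  exists Rel, is_finite_presentation N b Rel /\
    dehn_bound (length b) Rel (fun n => T n * (2 * (n + T n * C) + 3)).
Proof.
  intros Hb HN HT.
  destruct (finitely_many_left_ideals_bounded_suffix b Hb HN) as (D & L & HDL).
  exists (true_relations b (S D + C + L)). apply (true_relations_presentation b C D); auto; try lia.
  intros w Hw Lw. apply (has_short_suffix_le b D D L); auto; lia.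
Qed.

Lemma homotopy_bound_of_dehn_bound {M : monoid} (a : list M) Rel T :
  is_finite_presentation M a Rel -> dehn_bound (length a) Rel T ->
  exists C, homotopy_bound a C (munit M) T.
Proof.
  intros (Hover & _ & Heq) HT.
  destruct (uniform_bound (fun lr C => length (fst lr) <= C /\ length (snd lr) <= C) (rules Rel))
    as [C HC].
  { intros lr n m L. lia. }
  { intros lr _. exists (length (fst lr) + length (snd lr)). lia. }
  assert (Hrules : forall l r, In (l, r) (rules Rel) ->
            letters_lt (length a) l /\ letters_lt (length a) r).
  { rewrite Forall_forall in Hover. intros l r [H|H]%in_rules; apply Hover in H; tauto. }
  exists C. intros n u v Hu Hv Lu Lv E. rewrite !act_unit, Heq in E by auto.
  generalize (HT n u v Hu Hv Lu Lv E). apply chain_mono.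
  intros u' v' (p & l & r & s & H & -> & ->). exists p, l, r, s.
  destruct (HC _ H). destruct (Hrules l r H). repeat split; auto.
  rewrite !act_unit, !pres_eval_app. f_equal. apply Heq; auto.
  apply rcong_chain. exists 1. apply chain_one. exists [], l, r, []. now rewrite !app_nil_r.
Qed.

Theorem theorem5p8 (M N : monoid) :
  finitely_generated M -> finitely_generated N ->
  finitely_many M (left_ideal M) -> finitely_many M (right_ideal M) ->
  finitely_many N (left_ideal N) -> finitely_many N (right_ideal N) ->
  quasi_isometric M N ->
  fp_solvable_wp M -> fp_solvable_wp N.
Proof.
  intros _ _ _ _ HN _ (A & B & f & HA & HB & Hqi) (a & Rel & Hpres & Hwp).
  destruct (computable_dehn_bound_of_solvable _ _ Hwp) as (T & HT & HD).
  destruct (homotopy_bound_of_dehn_bound a Rel T Hpres HD) as [C HC].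
  pose proof (spans_of_generates B HB) as Hspans.
  destruct (homotopy_bound_quasi_isometry A B f a B C T HA HB Hqi
              (proj1 (proj2 Hpres)) Hspans HC) as (C' & c & K & HC').
  destruct (presentation_of_homotopy_bound B C' _ Hspans HN HC') as (Rel' & Hpres' & HD').
  exists B, Rel'. split; [exact Hpres'|].
  refine (solvable_of_computable_dehn_bound _ _ _ _ HD').
  computability.
Qed.
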